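(* Let $n$ and $m$ be nonnegative integers. Let $R$ be a commutative ring. Let $A$ be an $n\times n$-matrix over $R$. Assume that all principal minors of $A$ equal $1$. Then all diagonal entries of $A^{m}$ equal $1$.
   Context: Rings are unital. A principal minor of an $n\times n$-matrix $A$ is the determinant of a principal submatrix of $A$, i.e., of a matrix obtained from $A$ by keeping only the rows and columns indexed by the elements of some subset $I$ of $\{1,2,\ldots,n\}$ (the same subset for the rows and the columns, in increasing order). The subset $I=\varnothing$ is allowed and gives the principal minor $1$ (the determinant of the $0\times 0$-matrix); $I=\{1,2,\ldots,n\}$ gives $\det A$. *)

(* Defs.v *)
From mathcomp Require Import all_boot all_order all_algebra.

Set Implicit Arguments.
Unset Strict Implicit.
Unset Printing Implicit Defensive.

Import GRing.Theory.

Local Open Scope ring_scope.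

(* [enum_val] lists the elements of [I] in increasing order. *)
Definition principal_submx (R : Type) (n : nat) (A : 'M[R]_n) (I : {set 'I_n}) :
    'M[R]_#|I| :=
  mxsub (@enum_val 'I_n (mem I)) (@enum_val 'I_n (mem I)) A.

(* [comPzRingType] rather than [comNzRingType]: the zero ring is allowed. *)
Definition principal_minor (R : comPzRingType) (n : nat) (A : 'M[R]_n)
    (I : {set 'I_n}) : R :=
  \det (principal_submx A I).

(* Main.v *)
Require Import Defs.
From HB Require Import structures.
From mathcomp Require Import all_boot all_order all_algebra.

Set Implicit Arguments.
Unset Strict Implicit.
Unset Printing Implicit Defensive.

Import GRing.Theory.

Local Open Scope ring_scope.

(** The determinant of [1 + diag(c) A] is the sum of all principal minors of [A],
    weighted by products of the [c i]; when these minors are all [1], it is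
    [\prod_i (1 + c i)]. Taking [c = -t] everywhere gives [det(1 - tA) = (1-t)^n],
    and taking instead [c i = 0] at one index gives
    [adj(1 - tA) i i = (1-t)^(n-1)]. Hence the generating function of the entries
    [(A^m) i i] is [(1-t)^(n-1) / (1-t)^n = 1 / (1-t)]. *)

(** Two block matrices, multiplied in either order, give block triangular products with these two
    determinants. *)
Lemma det_1D_mulmx (R : comPzRingType) (n k : nat)
    (U : 'M[R]_(n, k)) (V : 'M[R]_(k, n)) :
  \det (1%:M + U *m V) = \det (1%:M + V *m U).
Proof.
have /(congr1 determinant) : block_mx 1%:M (- U) V 1%:M *m block_mx 1%:M U 0 1%:M =
    block_mx 1%:M 0 V (1%:M + V *m U).
  by rewrite mulmx_block !(mulmx0, mulmx1, mul1mx, addr0) subrr addrC.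
have /(congr1 determinant) : block_mx 1%:M U 0 1%:M *m block_mx 1%:M (- U) V 1%:M =
    block_mx (1%:M + U *m V) 0 V 1%:M.
  by rewrite mulmx_block !(mul0mx, mulmx1, mul1mx, add0r) addNr.
rewrite !det_mulmx !det_lblock !det_ublock !det1 !mulr1 !mul1r.
by move=> -> ->.
Qed.

Lemma principal_minor_unit_rows (R : comPzRingType) (n : nat) (A : 'M[R]_n)
    (J : {set 'I_n}) :
  principal_minor A J = \det (\matrix_(i, j) if i \in J then A i j else (i == j)%:R).
Proof.
(* With the row selection [E] of [J], the right-hand matrix is [1 + E^T (E (A - 1))]
   and the principal submatrix is [1 + (E (A - 1)) E^T]. *)
pose e := @enum_val 'I_n (mem J).
pose E : 'M[R]_(#|J|, n) := rowsub e 1%:M.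
have EM p (M : 'M[R]_(n, p)) : E *m M = rowsub e M by rewrite mul_rowsub_mx mul1mx.
have -> : principal_minor A J = \det (1%:M + (E *m (A - 1%:M)) *m E^T).
  congr (\det _); apply/matrixP => k l.
  have e_inj : injective e by apply: enum_val_inj.
  rewrite EM; transitivity (A (e k) (e l)); first by rewrite mxE.
  rewrite !mxE (bigD1 (e l)) //= big1 => [|j /negPf jl]; rewrite !mxE.
    by rewrite eqxx mulr1 addr0 (inj_eq e_inj) addrC subrK.
  by rewrite [e l == j]eq_sym jl mulr0.
rewrite -det_1D_mulmx mulmxA; congr (\det _); apply/matrixP => i j.
(* [E^T *m E] is the diagonal projection onto the coordinates in [J]: adding its product with
   [A - 1] to [1] turns exactly the rows in [J] into rows of [A]. *)
have EE l : (E^T *m E) i l = ((i \in J) && (i == l))%:R.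
  rewrite !mxE; case: (boolP (i \in J)) => [iJ|iNJ] /=.
    rewrite (bigD1 (enum_rank_in iJ i)) //= big1 => [|k ki]; rewrite !mxE.
      by rewrite /e enum_rankK_in // eqxx mul1r addr0.
    case: eqP => [ei|]; last by rewrite mul0r.
    by case/eqP: ki; apply: enum_val_inj; rewrite enum_rankK_in.
  rewrite big1 // => k _; rewrite !mxE; case: eqP => [ei|]; last by rewrite mul0r.
  by rewrite -ei enum_valP in iNJ.
rewrite mxE [X in _ + X]mxE (bigD1 i) //= big1 => [|l /negPf li]; last first.
  by rewrite EE eq_sym li andbF mul0r.
rewrite EE eqxx andbT !mxE; case: ifP => _; rewrite ?mul0r ?mul1r !addr0 //.
by rewrite addrC subrK.
Qed.

(** Each Leibniz term is a product of binomials. It expands over the set [J] of rows where the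
    summand with [c i] is chosen; the other rows are unit rows. *)
Lemma det_1D_diag_mul (R : comPzRingType) (n : nat) (A : 'M[R]_n) (c : 'I_n -> R) :
  \det (\matrix_(i, j) ((i == j)%:R + c i * A i j)) =
  \sum_(J : {set 'I_n}) (\prod_(i in J) c i) * principal_minor A J.
Proof.
under eq_bigr do rewrite principal_minor_unit_rows mulr_sumr.
rewrite exchange_big /=; apply: eq_bigr => s _.
under [RHS]eq_bigr do rewrite mulrCA.
rewrite -mulr_sumr; congr (_ * _).
under [LHS]eq_bigr do rewrite mxE addrC.
rewrite bigA_distr; apply: eq_bigr => J _.
rewrite [X in X * _]big_mkcond -big_split /=; apply: eq_bigr => i _.
by rewrite mxE; case: ifP; rewrite ?mul1r.
Qed.

Lemma det_1D_diag_mul_minors1 (R : comPzRingType) (n : nat) (A : 'M[R]_n)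
    (c : 'I_n -> R) :
    (forall J : {set 'I_n}, principal_minor A J = 1) ->
  \det (\matrix_(i, j) ((i == j)%:R + c i * A i j)) = \prod_i (1 + c i).
Proof.
move=> A1; rewrite det_1D_diag_mul.
under [RHS]eq_bigr do rewrite addrC.
rewrite bigA_distr; apply: eq_bigr => J _.
by rewrite A1 mulr1 big_mkcond.
Qed.

Lemma det_1B_scale_minors1 (R : comPzRingType) (n : nat) (A : 'M[R]_n.+1)
    (t : R) :
    (forall J : {set 'I_n.+1}, principal_minor A J = 1) ->
  \det (1 - t *: A) = (1 - t) ^+ n.+1.
Proof.
move=> A1; rewrite -[in RHS](card_ord n.+1) -prodr_const -(det_1D_diag_mul_minors1 _ A1).
by congr (\det _); apply/matrixP => i j; rewrite !mxE mulNr.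
Qed.

Lemma adj_diag_1B_scale_minors1 (R : comPzRingType) (n : nat) (A : 'M[R]_n.+1)
    (t : R) (i : 'I_n.+1) :
    (forall J : {set 'I_n.+1}, principal_minor A J = 1) ->
  (\adj (1 - t *: A)) i i = (1 - t) ^+ n.
Proof.
move=> A1; pose c j := if j == i then 0 else - t.
transitivity (\prod_j (1 + c j)); last first.
  rewrite (bigD1 i) //= /c eqxx addr0 mul1r.
  under eq_bigr => j /negPf -> do [].
  by rewrite prodr_const cardC1 card_ord.
(* As [c i = 0], row [i] is a unit row, so Laplace expansion along it leaves only the cofactor at
   [(i, i)], which is that of [1 - t *: A]. *)
rewrite -(det_1D_diag_mul_minors1 _ A1) (expand_det_row _ i) (bigD1 i) //=.
rewrite big1 => [|j /negPf ji]; last first.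
  by rewrite !mxE /c eqxx eq_sym ji !mul0r addr0 mul0r.
rewrite !mxE /c eqxx mul0r !addr0 mul1r; congr (_ * \det _).
by apply/matrixP => k l; rewrite !mxE [_ == i]eq_sym (negPf (neq_lift _ _)) mulNr.
Qed.

(** Powers of [1 - 'X] cancel modulo ['X^(m.+1)]: coefficient [j.+1] of [(1 - 'X) * p] is the
    difference of two consecutive coefficients of [p]. *)
Lemma coef_eq0_mul_1BX_exp (R : nzRingType) (m k : nat) (p : {poly R}) :
    (forall j, (j <= m)%N -> ((1 - 'X) ^+ k * p)`_j = 0) ->
  forall j, (j <= m)%N -> p`_j = 0.
Proof.
elim: k p => [|k IHk] p; first by rewrite expr0 mul1r.
rewrite exprSr -mulrA => /IHk {}IHk; elim=> [|j IHj] lejm.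
  by have := IHk 0 lejm; rewrite mulrBl mul1r coefB coefXM subr0.
by have := IHk _ lejm; rewrite mulrBl mul1r coefB coefXM /= IHj ?subr0 // ltnW.
Qed.

Lemma diag_exp_minors1 (R : comNzRingType) (n m : nat) (A : 'M[R]_n.+1) :
    (forall J : {set 'I_n.+1}, principal_minor A J = 1) ->
  forall i, (A ^+ m) i i = 1.
Proof.
move=> A1 i; pose P := map_mx (@polyC R) A; pose T := 'X *: P.
have P1 (J : {set 'I_n.+1}) : principal_minor P J = 1.
  by rewrite /principal_minor /principal_submx -map_mxsub det_map_mx [\det _]A1.
(* The generating function is truncated after degree [m], so that polynomials suffice. *)
pose s := \poly_(k < m.+1) (A ^+ k) i i.
have Es : (\sum_(k < m.+1) T ^+ k) i i = s.
  rewrite summxE /s poly_def; apply: eq_bigr => k _.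
  by rewrite exprZn mxE -rmorphXn mxE mulrC mul_polyC.
have geom : (1 - T) *m \sum_(k < m.+1) T ^+ k = 1 - T ^+ m.+1.
  by rewrite -[LHS]opprK -mulNmx opprB -[X in - X]subrX1 opprB.
(* This is the [(i, i)] entry of [geom] multiplied on the left by the adjugate of [1 - T], with the
   term [(1 - 'X) ^+ n] moved to the left. *)
have key :
    (1 - 'X) ^+ n * ((1 - 'X) * s - 1) =
    - ('X^(m.+1) * (\adj (1 - T) *m P ^+ m.+1) i i).
  have /(congr1 (fun M : 'M_n.+1 => M i i)) := congr1 (mulmx (\adj (1 - T))) geom.
  rewrite mulmxA mul_adj_mx mul_scalar_mx mxE Es det_1B_scale_minors1 //.
  have -> : (\adj (1 - T) *m (1 - T ^+ m.+1)) i i =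
      (1 - 'X) ^+ n - 'X^(m.+1) * (\adj (1 - T) *m P ^+ m.+1) i i.
    rewrite mulmxBr mulmx1 exprZn -scalemxAr -(adj_diag_1B_scale_minors1 'X i P1).
    by rewrite !mxE.
  by rewrite mulrBr mulrA mulr1 -exprSr => ->; rewrite addrC addKr.
have c0 j : (j <= m)%N -> ((1 - 'X) * s - 1)`_j = 0.
  apply: (@coef_eq0_mul_1BX_exp _ _ n) => {}j lejm.
  by rewrite key coefN coefXnM ltnS lejm oppr0.
(* Since [(1 - 'X) * s] agrees with [1] up to degree [m], [s] starts with [1] and its consecutive
   coefficients are equal. *)
have s1 j : (j <= m)%N -> s`_j = 1.
  elim: j => [|j IHj] lejm; have := c0 _ lejm.
    by rewrite mulrBl mul1r !coefB coefXM coef1 subr0 => /subr0_eq.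
  by rewrite mulrBl mul1r !coefB coefXM coef1 /= subr0 (IHj (ltnW lejm)) => /subr0_eq.
by rewrite -(s1 m) // coef_poly ltnSn.
Qed.

Theorem theorem5p2 (n m : nat) (R : comPzRingType) (A : 'M[R]_n)
    (hA : forall I : {set 'I_n}, principal_minor A I = 1) :
  forall i : 'I_n, (A ^+ m) i i = 1.
Proof.
case: n A hA => [|n] A hA i; first by case: i.
(* [{poly R}] requires a nontrivial ring. *)
have [R0|Rnz] := eqVneq (1 : R) 0; first by rewrite -[LHS]mulr1 -[RHS]mulr1 R0 !mulr0.
pose R' : comNzRingType := HB.pack R (GRing.PzSemiRing_isNonZero.Build R Rnz).
exact: (@diag_exp_minors1 R' n m A hA i).
Qed.
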